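(* The permutation statistic $\operatorname{pk}$ (peak number) is shuffle compatible.
   Context: For a finite set $U$ of positive integers, a permutation of $U$ is a linear order $\pi=\pi_1\pi_2\cdots\pi_m$ of all the elements of $U$ (each appearing exactly once); write $\operatorname{dom}(\pi)=U$, $|\pi|=|U|=m$, and let $L(U)$ be the set of permutations of $U$. Two permutations $\pi\in L(U)$, $\pi'\in L(V)$ with $|U|=|V|$ have the same relative order if applying the unique strictly increasing bijection $U\to V$ to the entries of $\pi$ gives $\pi'$. A permutation statistic is a map $\operatorname{St}$ defined on all permutations of all finite sets of positive integers such that $\operatorname{St}(\pi)=\operatorname{St}(\pi')$ whenever $\pi$ and $\pi'$ have the same relative order. For permutations $\pi,\sigma$ with disjoint domains, the shuffle set $\operatorname{Sh}(\pi,\sigma)$ is the set of all $\tau\in L(\operatorname{dom}(\pi)\sqcup\operatorname{dom}(\sigma))$ containing both $\pi$ and $\sigma$ as (not necessarily contiguous) subwords. For a set $\Pi$ of permutations, $\operatorname{St}(\Pi)$ denotes the multiset $\{\{\operatorname{St}(\pi) : \pi\in\Pi\}\}$. A permutation statistic $\operatorname{St}$ is shuffle compatible if for all permutations $\pi,\pi',\sigma,\sigma'$ with $|\pi|=|\pi'|$, $|\sigma|=|\sigma'|$, $\operatorname{dom}(\pi)\cap\operatorname{dom}(\sigma)=\operatorname{dom}(\pi')\cap\operatorname{dom}(\sigma')=\emptyset$, $\operatorname{St}(\pi)=\operatorname{St}(\pi')$ and $\operatorname{St}(\sigma)=\operatorname{St}(\sigma')$, one has the equality of multisets $\operatorname{St}(\operatorname{Sh}(\pi,\sigma))=\operatorname{St}(\operatorname{Sh}(\pi',\sigma'))$.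 For $\pi=\pi_1\cdots\pi_m$: $\operatorname{Pk}(\pi)=\{i : 2\le i\le m-1,\ \pi_{i-1}<\pi_i>\pi_{i+1}\}$ and $\operatorname{pk}(\pi)=|\operatorname{Pk}(\pi)|$. *)

(* Defs.v *)
From mathcomp Require Import all_boot.

Set Implicit Arguments.
Unset Strict Implicit.
Unset Printing Implicit Defensive.

(* A permutation of a finite set U of positive integers is the word listing
   the elements of U; U is recovered as the set of letters of the word. *)
Definition is_perm (p : seq nat) : bool := uniq p && all (ltn 0) p.

Definition disjoint_dom (p s : seq nat) : Prop :=
  forall x, ~ (x \in p /\ x \in s).

(* For permutations p and q, such an f restricts to the strictly increasing
   bijection from the letters of p onto those of q. *)
Definition same_rel_order (p q : seq nat) : Prop :=
  exists2 f : nat -> nat, {in p &, {homo f : x y / x < y}} & q = map f p.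

(* The values of a statistic on words that are not permutations are junk:
   nothing is required of them and they are never used. *)
Record perm_stat (T : Type) := PermStat {
  stat_fun :> seq nat -> T;
  stat_rel_order : forall p q, is_perm p -> is_perm q ->
    same_rel_order p q -> stat_fun p = stat_fun q
}.

(* For permutations p and s with disjoint domains, the words of
   [permutations (p ++ s)] are, without repetition, the elements of
   L(dom p + dom s). *)
Definition Sh (p s : seq nat) : seq (seq nat) :=
  [seq t <- permutations (p ++ s) | subseq p t && subseq s t].

(* Equality of multisets is [perm_eq]. *)
Definition shuffle_compatible (T : eqType) (St : perm_stat T) : Prop :=
  forall p p' s s' : seq nat,
    is_perm p -> is_perm p' -> is_perm s -> is_perm s' ->
    size p = size p' -> size s = size s' ->
    disjoint_dom p s -> disjoint_dom p' s' ->
    St p = St p' -> St s = St s' ->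
    perm_eq [seq St t | t <- Sh p s] [seq St t | t <- Sh p' s'].

Definition letter (p : seq nat) (i : nat) : nat := nth 0 p i.-1. (* 1-based *)

(* [index_iota 2 m] lists the i such that 2 <= i <= m - 1. *)
Definition Pk (p : seq nat) : seq nat :=
  [seq i <- index_iota 2 (size p) |
    (letter p i.-1 < letter p i) && (letter p i > letter p i.+1)].

Definition pk_fun (p : seq nat) : nat := size (Pk p).

Lemma pk_rel_order (p q : seq nat) : is_perm p -> is_perm q ->
  same_rel_order p q -> pk_fun p = pk_fun q.
Proof.
move=> _ _ [f fP ->]; rewrite /pk_fun /Pk size_map; congr size.
have fE : {in p &, forall x y, (f x < f y) = (x < y)}.
  move=> x y xp yp; case: (ltngtP x y) => [xy|yx|->]; last exact: ltnn.
  - exact: fP.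
  - by apply/negbTE; rewrite -leqNgt ltnW // fP.
apply: eq_in_filter => i; rewrite mem_index_iota => /andP[i2 im].
have i1 : i.-1 < size p by exact: leq_ltn_trans (leq_pred i) im.
have i0 : i.-2 < size p by exact: leq_ltn_trans (leq_pred _) i1.
by rewrite /letter !(nth_map 0) // !fE ?mem_nth.
Qed.

Definition pk : perm_stat nat := PermStat pk_rel_order.

(* Main.v *)
Require Import Defs.
From mathcomp Require Import all_boot zify.

Set Implicit Arguments.
Unset Strict Implicit.
Unset Printing Implicit Defensive.

(** The statistic pk is separated by a family of functions on words that are
    compatible with shuffling.  Say that f is multiplicative when the sum of f
    over the shuffles of p and s is f p * f s.  Three facts are used.

    - The indicator of increasing words is multiplicative, because two disjoint
      increasing words have exactly one increasing shuffle; so is the indicator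
      of decreasing words [multiplicative_sorted].
    - Cutting a shuffle of p and s in two amounts to cutting p and s in two and
      shuffling the left parts and the right parts [sum_shuffles_splits].
      Hence multiplicative functions are closed under the convolution
      (f * g)(w) = sum over w = u v of f(u) g(v).
    - Convolving the indicators of decreasing and of increasing words gives the
      function [v_weight], equal to 1 on the empty word and, on other words, to
      twice the indicator of having no peak: a word without peaks decreases
      and then increases, and its least letter may go on either side.

    Let [enriched m] be the m-fold convolution power of [v_weight]; it counts
    the enriched P-partitions, in the sense of Stembridge, of a chain labelled
    by w, with parts of absolute value at most m.  It is multiplicative.
    A cut of w into peakless pieces is a set of gaps that meets, for each peak,
    the pair of gaps next to it.  These pairs are disjoint, so the number of
    such cuts of each size depends on |w| and pk w only, and so does
    enriched m w: this is [enrichedE].  The recursion on the first letters that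
    proves it multiplies, for the operator x = [dsum], by 1 + x at each gap
    away from the peaks and by 2 x + x^2 at each peak.

    Finally, a nonempty word with k peaks needs at least k + 1 peakless pieces,
    and k + 1 are enough.  Hence enriched m w vanishes for m <= pk w and not for
    m = pk w + 1.  So if the sums of enriched m over two collections of words of
    the same positive length agree for all m, triangularity shows that both collections
    have the same number of words with k peaks, for every k
    [triangular_perm_eq].  By multiplicativity the sum over the shuffles of p
    and s is enriched m p * enriched m s, which depends on the lengths and the
    peak numbers of p and s only. *)

(** * Shuffles *)

Fixpoint shuffles (p : seq nat) : seq nat -> seq (seq nat) :=
  if p is a :: p' then
    fix shuffles_p (s : seq nat) : seq (seq nat) :=
      if s is b :: s' then
        map (cons a) (shuffles p' s) ++ map (cons b) (shuffles_p s')
      else [:: p]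
  else fun s => [:: s].

Arguments shuffles : simpl never.

Lemma shuffles_nil_r p : shuffles p [::] = [:: p].
Proof. by case: p. Qed.

Lemma shuffles_cons a p b s : shuffles (a :: p) (b :: s) =
  map (cons a) (shuffles p (b :: s)) ++ map (cons b) (shuffles (a :: p) s).
Proof. by []. Qed.

Lemma shuffles_ind (Q : seq nat -> seq nat -> Prop) :
    (forall s, Q [::] s) -> (forall p, Q p [::]) ->
    (forall a p b s, Q p (b :: s) -> Q (a :: p) s -> Q (a :: p) (b :: s)) ->
  forall p s, Q p s.
Proof.
move=> Q0s Qp0 QS; elim=> [|a p IHp] //; elim=> [|b s IHs] //.
exact: QS.
Qed.

Lemma shufflesP p s t : t \in shuffles p s ->
  [/\ perm_eq t (p ++ s), subseq p t & subseq s t].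
Proof.
move: p s t; apply: shuffles_ind => [s t|p t|a p b s IHa IHb].
- by rewrite inE => /eqP ->; rewrite sub0seq subseq_refl perm_refl.
- by rewrite shuffles_nil_r inE => /eqP ->; rewrite sub0seq cats0 subseq_refl.
- move=> t; rewrite shuffles_cons mem_cat => /orP[] /mapP[u u_sh ->].
  + have [pu su1 su2] := IHa _ u_sh.
    by rewrite cat_cons perm_cons pu /= eqxx su1; split=> //; case: ifP => // _;
       apply: subseq_trans su2; exact: subseq_cons.
  + have [pu su1 su2] := IHb _ u_sh.
    split; last by rewrite /= eqxx.
      by rewrite perm_sym -cat_rcons -cats1 -catA perm_catCA /= perm_cons perm_sym.
    exact: subseq_trans su1 (subseq_cons _ _).
Qed.

Lemma uniq_cat_cons (a b : nat) p s : uniq ((a :: p) ++ b :: s) ->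
  [/\ a != b, uniq (p ++ b :: s) & uniq ((a :: p) ++ s)].
Proof.
move=> Us; have /andP[aN Us1] := Us; split=> //.
  by apply: contraNneq aN => ->; rewrite mem_cat inE eqxx orbT.
by apply: subseq_uniq Us; apply: cat_subseq => //; exact: subseq_cons.
Qed.

(** The first letter of t must start p or s: otherwise the tail of t would
    contain all the letters of both words, and it is too short for that. *)
Lemma mem_shuffles p s t : uniq (p ++ s) -> size t = size p + size s ->
  subseq p t -> subseq s t -> t \in shuffles p s.
Proof.
move: p s t; apply: shuffles_ind => [s t|p t|a p b s IHa IHb].
- move=> _ sz _ st; rewrite inE eq_sym.
  by rewrite -(size_subseq_leqif st) sz.
- move=> _ sz pt _; rewrite shuffles_nil_r inE eq_sym.
  by rewrite -(size_subseq_leqif pt) sz addn0.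
- case=> [|x t] // Us sz pt st.
  have [aNb Us1 Us2] := uniq_cat_cons Us.
  rewrite shuffles_cons mem_cat.
  have [xa|xNa] := eqVneq x a.
    subst x; apply/orP; left; apply: map_f; apply: IHa => //.
    + by move: sz => /=; lia.
    + by move: pt; rewrite /= eqxx.
    + by move: st; rewrite /= eq_sym (negbTE aNb).
  have [xb|xNb] := eqVneq x b.
    subst x; apply/orP; right; apply: map_f; apply: IHb => //.
    + by move: sz => /=; lia.
    + by move: pt; rewrite /= (negbTE aNb).
    + by move: st; rewrite /= eqxx.
  have ptl : subseq (a :: p) t by move: pt; rewrite /= eq_sym (negbTE xNa).
  have stl : subseq (b :: s) t by move: st; rewrite /= eq_sym (negbTE xNb).
  have : size ((a :: p) ++ b :: s) <= size t.
    apply: uniq_leq_size => // y; rewrite mem_cat => /orP[].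
      exact: (mem_subseq ptl).
    exact: (mem_subseq stl).
  by rewrite size_cat; move: sz => /=; lia.
Qed.

Lemma uniq_shuffles p s : uniq (p ++ s) -> uniq (shuffles p s).
Proof.
move: p s; apply: shuffles_ind => [s|p|a p b s IHa IHb] //.
  by rewrite shuffles_nil_r.
move=> Us; have [aNb Us1 Us2] := uniq_cat_cons Us.
rewrite shuffles_cons cat_uniq !map_inj_uniq; try by move=> ? ? [].
rewrite IHa // IHb // andbT /=.
apply/hasPn => _ /mapP[u _ ->]; apply/mapP => -[v _ [ba _]].
by rewrite ba eqxx in aNb.
Qed.

Lemma Sh_shuffles p s : uniq (p ++ s) -> perm_eq (Sh p s) (shuffles p s).
Proof.
move=> Us; apply: uniq_perm.
- by rewrite filter_uniq // permutations_uniq.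
- exact: uniq_shuffles.
- move=> t; rewrite mem_filter mem_permutations; apply/idP/idP.
    case/andP=> /andP[pt st] /perm_size sz.
    by apply: mem_shuffles; rewrite // sz size_cat.
  by case/shufflesP => -> -> ->.
Qed.

(** * Cutting words and multiplicative functions *)

Fixpoint splits (w : seq nat) : seq (seq nat * seq nat) :=
  ([::], w) ::
    (if w is a :: w' then [seq (a :: c.1, c.2) | c <- splits w'] else [::]).

Lemma sum_splits_cons (F : seq nat -> seq nat -> nat) a w :
  \sum_(c <- splits (a :: w)) F c.1 c.2 =
  F [::] (a :: w) + \sum_(c <- splits w) F (a :: c.1) c.2.
Proof. by rewrite big_cons big_map. Qed.

Lemma mem_splits w c : c \in splits w -> w = c.1 ++ c.2.
Proof.
elim: w c => [|a w IH] c; rewrite inE; first by move/eqP ->.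
by case/orP=> [/eqP -> // | /mapP[e /IH {1}-> ->]].
Qed.

(** This is the compatibility of shuffling (a product) with deconcatenation
    (a coproduct).  The general F, rather than a product f u * g v, lets the
    induction absorb the first letter of a shuffle into F. *)
Lemma sum_shuffles_splits (F : seq nat -> seq nat -> nat) p s :
  \sum_(t <- shuffles p s) \sum_(c <- splits t) F c.1 c.2 =
  \sum_(c <- splits p) \sum_(e <- splits s)
    \sum_(u <- shuffles c.1 e.1) \sum_(v <- shuffles c.2 e.2) F u v.
Proof.
move: p s F; apply: shuffles_ind => [s F|p F|a p b s IHa IHb F].
- rewrite !big_seq1; apply: eq_bigr => e _.
  by rewrite !big_seq1.
- rewrite shuffles_nil_r big_seq1; apply: eq_bigr => c _.
  by rewrite big_seq1 /= !shuffles_nil_r !big_seq1.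
- have sumS F' d w : \sum_(t <- splits (d :: w)) F' t =
      F' ([::], d :: w) + \sum_(c <- splits w) F' (d :: c.1, c.2).
    by rewrite big_cons big_map.
  rewrite shuffles_cons big_cat !big_map.
  under eq_bigr => t _ do rewrite sum_splits_cons.
  rewrite big_split /= (IHa (fun u v => F (a :: u) v)).
  under [X in _ + X = _]eq_bigr => t _ do rewrite sum_splits_cons.
  rewrite big_split /= (IHb (fun u v => F (b :: u) v)).
  rewrite [in RHS]sumS /= [X in _ = X + _]sumS /=.
  rewrite [X in _ + (_ + X) = _]sumS /=.
  under [X in _ = _ + X]eq_bigr => c _ do rewrite sumS.
  under [X in _ + X + _ = _]eq_bigr => c _ do rewrite sumS.
  rewrite !big_split /= !big_seq1 shuffles_cons big_cat !big_map /=.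
  have E1 : \sum_(e <- splits s) \sum_(u <- shuffles [::] (b :: e.1))
      \sum_(v <- shuffles (a :: p) e.2) F u v =
    \sum_(e <- splits s) \sum_(u <- shuffles [::] e.1)
      \sum_(v <- shuffles (a :: p) e.2) F (b :: u) v.
    by apply: eq_bigr => e _; rewrite !big_seq1.
  have E2 : \sum_(c <- splits p) \sum_(u <- shuffles (a :: c.1) [::])
      \sum_(v <- shuffles c.2 (b :: s)) F u v =
    \sum_(c <- splits p) \sum_(u <- shuffles c.1 [::])
      \sum_(v <- shuffles c.2 (b :: s)) F (a :: u) v.
    by apply: eq_bigr => c _; rewrite !shuffles_nil_r !big_seq1.
  rewrite E1 E2.
  have -> : \sum_(c <- splits p) \sum_(e <- splits s)
      \sum_(u <- shuffles (a :: c.1) (b :: e.1))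
        \sum_(v <- shuffles c.2 e.2) F u v =
    \sum_(c <- splits p) \sum_(e <- splits s)
      \sum_(u <- shuffles c.1 (b :: e.1))
        \sum_(v <- shuffles c.2 e.2) F (a :: u) v +
    \sum_(c <- splits p) \sum_(e <- splits s)
      \sum_(u <- shuffles (a :: c.1) e.1)
        \sum_(v <- shuffles c.2 e.2) F (b :: u) v.
    rewrite -big_split; apply: eq_bigr => c _.
    rewrite -big_split; apply: eq_bigr => e _.
    by rewrite shuffles_cons big_cat !big_map.
  lia.
Qed.

Definition multiplicative (f : seq nat -> nat) : Prop :=
  forall p s, uniq (p ++ s) -> \sum_(t <- shuffles p s) f t = f p * f s.

Definition conv (f g : seq nat -> nat) (w : seq nat) : nat :=
  \sum_(c <- splits w) f c.1 * g c.2.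

Lemma conv_nil f g : conv f g [::] = f [::] * g [::].
Proof. exact: big_seq1. Qed.

Lemma conv_cons f g a w :
  conv f g (a :: w) = f [::] * g (a :: w) + conv (fun u => f (a :: u)) g w.
Proof. exact: (sum_splits_cons (fun u v => f u * g v)). Qed.

Lemma eq_conv f f' g w : f =1 f' -> conv f g w = conv f' g w.
Proof. by move=> ff'; apply: eq_bigr => c _; rewrite ff'. Qed.

Lemma eq_multiplicative f g : (forall w, uniq w -> f w = g w) ->
  multiplicative f -> multiplicative g.
Proof.
move=> fg fM p s Us; have := Us; rewrite cat_uniq => /and3P[Up _ Uq].
rewrite -!fg // -fM //; apply: eq_big_seq => t /shufflesP[tps _ _].
by rewrite fg // (perm_uniq tps).
Qed.

Lemma multiplicative_conv f g :
  multiplicative f -> multiplicative g -> multiplicative (conv f g).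
Proof.
move=> fM gM p s Us.
rewrite /conv (sum_shuffles_splits (fun u v => f u * g v)) big_distrlr /=.
apply: eq_big_seq => c /mem_splits pE; apply: eq_big_seq => e /mem_splits sE.
rewrite -big_distrlr /= fM ?gM; first by rewrite mulnACA.
- apply: subseq_uniq Us; rewrite pE sE; apply: cat_subseq; exact: suffix_subseq.
- apply: subseq_uniq Us; rewrite pE sE; apply: cat_subseq; exact: prefix_subseq.
Qed.

(** A total order leaves exactly one sorted shuffle when both words are sorted:
    of the two possible first letters a and b, only the smaller one can start
    a sorted word, and the rest is decided by induction. *)
Lemma multiplicative_sorted (e : rel nat) : transitive e ->
    (forall x y, x != y -> e x y = ~~ e y x) ->
  multiplicative (fun w => sorted e w).
Proof.
move=> eT eN; apply: shuffles_ind => [s|p|a p b s IHa IHb] Us.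
- by rewrite big_seq1 mul1n.
- by rewrite shuffles_nil_r big_seq1 muln1.
- have [aNb Us1 Us2] := uniq_cat_cons Us.
  have sumE d q r :
      \sum_(t <- shuffles q r) sorted e (d :: t) =
      (all (e d) q && all (e d) r) * \sum_(t <- shuffles q r) sorted e t.
    rewrite big_distrr; apply: eq_big_seq => t /shufflesP[tqr _ _].
    by rewrite /= (path_sortedE eT) (perm_all _ tqr) all_cat mulnb.
  rewrite shuffles_cons big_cat !big_map /=.
  rewrite (sumE a) (sumE b) IHa // IHb // !mulnb /=.
  rewrite !(path_sortedE eT) (eN b a) 1?eq_sym //.
  case eab: (e a b) => /=; rewrite ?andbF /= ?addn0 ?add0n.
  + case bs: (all (e b) s); rewrite ?andbF //=.
    have -> : all (e a) s.
      by apply/allP => y /(allP bs); exact: eT.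
    by rewrite andbT; case: (all _ p); case: (sorted e p); case: (sorted e s).
  + have eba : e b a by rewrite eN 1?eq_sym // eab.
    case ap: (all (e a) p); rewrite ?andbF //=.
    have -> : all (e b) p.
      by apply/allP => y /(allP ap); exact: eT.
    by case: (all _ s); case: (sorted e p); case: (sorted e s).
Qed.

(** * Peakless words *)

Definition starts_with_peak (a b : nat) (w : seq nat) : bool :=
  if w is c :: _ then (a < b) && (c < b) else false.

Lemma starts_with_descent a b w : b < a -> starts_with_peak a b w = false.
Proof. by case: w => //= c w ba; rewrite ltnNge (ltnW ba). Qed.

Lemma pk_cons a b w :
  pk_fun (a :: b :: w) = starts_with_peak a b w + pk_fun (b :: w).
Proof.
case: w => [|c w] //.
(* Dropping the first letter shifts by one the positions of the other peaks. *)
rewrite /pk_fun /Pk /= /index_iota !subSS !subn0 /= /letter /=.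
rewrite (iotaDl 1 2 (size w)) filter_map (fun_if size) /= size_map.
set l := filter _ _; set r := filter _ _.
have -> : l = r by apply: eq_in_filter => -[|[|i]]; rewrite mem_iota.
by case: ifP.
Qed.

(** After an ascent, the first descent would create a peak. *)
Lemma pk_sorted a b w : uniq (a :: b :: w) -> a < b ->
  (pk_fun (a :: b :: w) == 0) = sorted ltn (b :: w).
Proof.
elim: w a b => [|c w IH] a b // Us ab.
have bNc : b != c by move: Us => /= /and3P[_]; rewrite inE negb_or => /andP[].
rewrite pk_cons /= ab /=; case: (ltngtP b c) bNc => // bc _ /=.
by rewrite add0n IH //; case/andP: Us.
Qed.

Definition v_weight (w : seq nat) : nat :=
  if w is [::] then 1 else 2 * (pk_fun w == 0).

(** A nonempty word factors into a decreasing u and an increasing v only if it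
    has no peak, and there are then two ways: the least letter ends
    u or starts v.  In the induction, an initial ascent forces u to have at
    most one letter, while an initial descent transfers the count from the
    word without its first letter. *)
Lemma conv_sorted w : uniq w ->
  conv (fun u => sorted gtn u) (fun v => sorted ltn v) w = v_weight w.
Proof.
case: w => [|a w]; first by rewrite conv_nil.
elim: w a => [|b w IH] a; first by rewrite conv_cons conv_nil.
move=> Us; have Us1 : uniq (b :: w) by case/andP: Us.
have aNb : a != b by move: Us => /=; rewrite inE negb_or => /andP[/andP[]].
rewrite conv_cons conv_cons.
have := IH b Us1; rewrite conv_cons /v_weight.
case: (ltngtP a b) aNb => // ab _.
- have -> : conv (fun u => sorted gtn [:: a, b & u]) (fun v => sorted ltn v) w = 0.
    by rewrite /conv big1 // => c _; rewrite /= ltnNge (ltnW ab).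
  by move=> _; rewrite pk_sorted //= ab; lia.
- have -> : conv (fun u => sorted gtn [:: a, b & u]) (fun v => sorted ltn v) w
      = conv (fun u => sorted gtn (b :: u)) (fun v => sorted ltn v) w.
    by apply: eq_conv => u /=; rewrite ab.
  have -> : pk_fun (a :: b :: w) = pk_fun (b :: w).
    by rewrite pk_cons starts_with_descent.
  by rewrite /= [a < b]ltnNge (ltnW ab) /=; lia.
Qed.

Lemma multiplicative_v_weight : multiplicative v_weight.
Proof.
apply: eq_multiplicative conv_sorted _.
apply: multiplicative_conv; apply: multiplicative_sorted.
- by move=> y x z /= xy yz; apply: ltn_trans yz xy.
- by move=> x y /=; case: ltngtP.
- exact: ltn_trans.
- by move=> x y /=; case: ltngtP.
Qed.

(** * Counting enriched P-partitions *)

Fixpoint enriched (m : nat) : seq nat -> nat :=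
  if m is m'.+1 then conv v_weight (enriched m') else fun w => nilp w.

Lemma multiplicative_enriched m : multiplicative (enriched m).
Proof.
elim: m => [|m IH] /=; last exact: multiplicative_conv multiplicative_v_weight IH.
case=> [|a p] [|b s] Us; rewrite ?big_seq1 ?shuffles_nil_r ?big_seq1 //.
by rewrite shuffles_cons big_cat !big_map /= !big1.
Qed.

Lemma enriched_nil m : enriched m [::] = 1.
Proof. by elim: m => //= m IH; rewrite conv_nil IH. Qed.

(** The forward difference of [enriched m (a :: w)] in m: the part of the next
    convolution in which the first piece is not empty.  It obeys simpler
    recursions on the word than [enriched] itself. *)
Definition tail_enriched (w : seq nat) (m : nat) : nat :=
  if w is a :: w' then conv (fun u => v_weight (a :: u)) (enriched m) w' else 1.

(** Twice the operator of summation in m.  With x for this operator,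
    [add_nonpeak] is 1 + x and [add_peak] is x (2 + x). *)
Definition dsum (g : nat -> nat) (m : nat) : nat := 2 * \sum_(i < m) g i.

Definition add_nonpeak (g : nat -> nat) (m : nat) : nat := g m + dsum g m.
Definition add_peak (g : nat -> nat) (m : nat) : nat :=
  dsum (fun i => g i + add_nonpeak g i) m.

Lemma dsumS g m : dsum g m.+1 = dsum g m + 2 * g m.
Proof. by rewrite /dsum big_ord_recr mulnDr. Qed.

Lemma eq_dsum g h : g =1 h -> dsum g =1 dsum h.
Proof. by move=> gh m; congr (_ * _); apply: eq_bigr => i _. Qed.

Lemma dsumD g h m : dsum (fun i => g i + h i) m = dsum g m + dsum h m.
Proof. by rewrite /dsum big_split mulnDr. Qed.

(** Both sides vanish at m = 0 and have the same differences. *)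
Lemma enriched_cons a w m :
  2 * enriched m (a :: w) = dsum (tail_enriched (a :: w)) m.
Proof.
elim: m => [|m IH]; first by rewrite /dsum big_ord0.
by rewrite dsumS -IH /= conv_cons -mulnDr mul1n.
Qed.

Lemma tail_enriched_single a m : tail_enriched [:: a] m = 2.
Proof. by rewrite /= conv_nil enriched_nil. Qed.

(** If b is not a peak, the gap after a may be cut (the term [dsum]) or not; in
    the latter case deleting a changes no weight, for the first piece has a
    peak after the deletion exactly when it had one before. *)
Lemma tail_enriched_nonpeak a b w : ~~ starts_with_peak a b w ->
  tail_enriched [:: a, b & w] =1 add_nonpeak (tail_enriched (b :: w)).
Proof.
move=> nab m; rewrite /add_nonpeak -enriched_cons addnC /= conv_cons.
congr (_ * _ + _); case: w nab => [|c w] nab; first by rewrite !conv_nil.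
rewrite !conv_cons; congr (_ * _ + _); apply: eq_conv => u.
have nabu : starts_with_peak a b (c :: u) = false := negbTE nab.
by rewrite /v_weight [pk_fun [:: a, b, c & u]]pk_cons nabu.
Qed.

(** If b is a peak, the first piece is a or ab, since abc has a peak.  It is
    followed by bcw or by cw, and b c is a descent, so that the previous lemma
    reduces bcw to cw. *)
Lemma tail_enriched_peak a b c w : starts_with_peak a b (c :: w) ->
  tail_enriched [:: a, b, c & w] =1 add_peak (tail_enriched (c :: w)).
Proof.
move=> abc m.
have vanish : conv (fun u => 2 * (pk_fun [:: a, b, c & u] == 0)) (enriched m) w = 0.
  by rewrite /conv big1 // => e _; rewrite pk_cons (abc : starts_with_peak a b (c :: e.1)).
have nbc : ~~ starts_with_peak b c w.
  by case/andP: abc => _ cb; rewrite starts_with_descent.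
rewrite /add_peak dsumD -(eq_dsum (tail_enriched_nonpeak nbc)) -!enriched_cons.
rewrite /= !conv_cons /v_weight vanish /=; lia.
Qed.

Lemma eq_add_nonpeak g h : g =1 h -> add_nonpeak g =1 add_nonpeak h.
Proof. by move=> gh m; rewrite /add_nonpeak gh (eq_dsum gh). Qed.

Lemma eq_add_peak g h : g =1 h -> add_peak g =1 add_peak h.
Proof.
by move=> gh; apply: eq_dsum => i; rewrite gh (eq_add_nonpeak gh).
Qed.

(** Both operators are polynomials in [dsum]. *)
Lemma add_nonpeakC g : add_nonpeak (add_peak g) =1 add_peak (add_nonpeak g).
Proof.
have AD h1 h2 m : add_nonpeak (fun i => h1 i + h2 i) m =
    add_nonpeak h1 m + add_nonpeak h2 m.
  by rewrite /add_nonpeak dsumD addnACA.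
have AS h m : add_nonpeak (dsum h) m = dsum (add_nonpeak h) m.
  by rewrite /add_nonpeak dsumD.
by move=> m; rewrite /add_peak AS; apply: eq_dsum => i; rewrite AD.
Qed.

(** The value (2 x + x^2)^k (1 + x)^q applied to the constant 2: with k peaks,
    and q gaps next to no peak. *)
Definition enriched_profile (k q : nat) : nat -> nat :=
  iter k add_peak (iter q add_nonpeak (fun=> 2)).

Lemma add_nonpeak_profile k q :
  add_nonpeak (enriched_profile k q) =1 enriched_profile k q.+1.
Proof.
elim: k => //= k IH m; rewrite add_nonpeakC; exact: eq_add_peak.
Qed.

(** The size of the tail w is the number of gaps of a :: w, two of which are
    next to each peak. *)
Lemma tail_enrichedE a w : exists2 q, size w = pk_fun (a :: w) * 2 + q &
  tail_enriched (a :: w) =1 enriched_profile (pk_fun (a :: w)) q.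
Proof.
have [n] := ubnP (size w); elim: n a w => // n IH a [|b w] /= wn.
  by exists 0 => // m; rewrite -[LHS]/(tail_enriched [:: a] m) tail_enriched_single.
have [abw|nabw] := boolP (starts_with_peak a b w); last first.
  have [q sz E] := IH b w wn.
  exists q.+1; first by rewrite pk_cons (negbTE nabw) sz add0n; lia.
  move=> m; rewrite -[LHS]/(tail_enriched [:: a, b & w] m) pk_cons (negbTE nabw).
  by rewrite tail_enriched_nonpeak // (eq_add_nonpeak E) add_nonpeak_profile.
case: w wn abw => [|c w] //= wn abc.
have [q sz E] := IH c w (ltnW wn).
have pkE : pk_fun [:: a, b, c & w] = (pk_fun (c :: w)).+1.
  by rewrite !pk_cons /= abc; case/andP: abc => _ cb; rewrite starts_with_descent.
exists q; first by rewrite pkE; lia.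
move=> m; rewrite -[LHS]/(tail_enriched [:: a, b, c & w] m) pkE.
by rewrite tail_enriched_peak // (eq_add_peak E).
Qed.

(** Words of size n > 0 have less than n / 2 peaks.  For larger k the truncated
    subtraction gives values that count nothing but still vanish up to m = k
    and not at m = k + 1, so the family stays triangular in k.  The values are
    twice those of [enriched], to avoid a division. *)
Definition enriched_count (n k m : nat) : nat :=
  dsum (enriched_profile k (n.-1 - k * 2)) m.

Lemma enrichedE w m : 0 < size w ->
  2 * enriched m w = enriched_count (size w) (pk_fun w) m.
Proof.
case: w => // a w _; have [q sz E] := tail_enrichedE a w.
by rewrite enriched_cons /enriched_count /= sz addKn; exact: eq_dsum.
Qed.

(** * Triangularity *)

Definition first_nonzero (g : nat -> nat) (k : nat) : Prop :=
  (forall i, i < k -> g i = 0) /\ 0 < g k.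

Lemma first_nonzero_dsum g k : first_nonzero g k -> first_nonzero (dsum g) k.+1.
Proof.
move=> [g0 gk]; split=> [i|]; last by rewrite dsumS; lia.
rewrite ltnS => ik; rewrite /dsum big1 // => j _.
exact/g0/(leq_trans (ltn_ord j)).
Qed.

Lemma first_nonzero_nonpeak g k :
  first_nonzero g k -> first_nonzero (add_nonpeak g) k.
Proof.
move=> gk; have [g0 gpos] := gk; have [d0 _] := first_nonzero_dsum gk.
split=> [i ik|]; last by rewrite /add_nonpeak; lia.
by rewrite /add_nonpeak g0 // d0 // ltnW.
Qed.

Lemma first_nonzero_profile k q : first_nonzero (enriched_profile k q) k.
Proof.
elim: k => [|k IH] /=; first by elim: q => // q; exact: first_nonzero_nonpeak.
apply: first_nonzero_dsum; have [g0 gk] := IH.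
have [h0 hk] := first_nonzero_nonpeak IH.
by split=> [i ik|]; [rewrite g0 // h0 | lia].
Qed.

Lemma sum_count_mem (F : nat -> nat) K L : (forall j, K <= j -> F j = 0) ->
  \sum_(j <- L) F j = \sum_(j < K) count_mem (j : nat) L * F j.
Proof.
move=> F0; elim: L => [|x L IH]; first by rewrite big_nil big1.
rewrite big_cons IH /=.
under [RHS]eq_bigr => j _ do rewrite mulnDl.
rewrite big_split /=; congr (_ + _).
have [xK|/F0 Fx] := ltnP x K.
  rewrite (bigD1 (Ordinal xK)) //= eqxx mul1n big1 ?addn0 // => j jx.
  by rewrite (_ : (x == j) = false) //; apply: contraNF jx => /eqP xj; apply/eqP/val_inj.
by rewrite big1 // => j _; case: eqP => // <-; rewrite Fx.
Qed.

(** The functions h k have distinct orders of vanishing, so they are linearly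
    independent: at k + 1, only the entries up to k contribute, and the number
    of entries equal to k is determined by the numbers of smaller ones. *)
Lemma triangular_perm_eq (h : nat -> nat -> nat) (L L' : seq nat) :
    (forall k, first_nonzero (h k) k.+1) ->
    (forall m, \sum_(k <- L) h k m = \sum_(k <- L') h k m) ->
  perm_eq L L'.
Proof.
move=> h_tri eqL.
have cnt k : count_mem k L = count_mem k L'.
  elim/ltn_ind: k => k IH; have := eqL k.+1.
  have h0 j : k.+1 <= j -> h j k.+1 = 0.
    by move=> kj; apply: (h_tri j).1.
  rewrite !(sum_count_mem _ h0) !big_ord_recr /=.
  under eq_bigr => j _ do rewrite IH //.
  by move/addnI/eqP; rewrite eqn_pmul2r ?(h_tri k).2 // => /eqP.
by apply/allP => k _; rewrite /= cnt.
Qed.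

Theorem theorem6p1 : shuffle_compatible pk.
Proof.
move=> p p' s s' /andP[Up _] /andP[Up' _] /andP[Us _] /andP[Us' _] szp szs.
move=> dps dps' pkp pks.
have disjoint_uniq q r : uniq q -> uniq r -> disjoint_dom q r -> uniq (q ++ r).
  move=> Uq Ur dqr; rewrite cat_uniq Uq Ur andbT; apply/hasPn => x xr.
  by apply/negP => xq; apply: (dqr x).
have Ups := disjoint_uniq _ _ Up Us dps.
have Ups' := disjoint_uniq _ _ Up' Us' dps'.
have E q r m : size q = size r -> pk_fun q = pk_fun r ->
    enriched m q = enriched m r.
  move=> sz pkE; have [q0|q0] := posnP (size q).
    by move: sz; rewrite q0 (size0nil q0) => /esym/size0nil ->.
  by apply/eqP; rewrite -(eqn_pmul2l (isT : 0 < 2)) !enrichedE -?sz // pkE.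
have shE q r m : uniq (q ++ r) -> 0 < size q + size r ->
    \sum_(k <- [seq pk t | t <- Sh q r]) enriched_count (size q + size r) k m =
    2 * (enriched m q * enriched m r).
  move=> Uqr n0; rewrite big_map (perm_big _ (Sh_shuffles Uqr)) /=.
  rewrite -multiplicative_enriched // big_distrr /=.
  apply: eq_big_seq => t /shufflesP[/perm_size tqr _ _].
  by rewrite enrichedE tqr size_cat.
(* [enriched_count] describes nonempty words only. *)
have [n0|n0] := posnP (size p + size s).
  move: n0 szp szs => /eqP; rewrite addn_eq0 => /andP[/eqP p0 /eqP s0].
  by rewrite p0 s0 (size0nil p0) (size0nil s0) => /esym/size0nil -> /esym/size0nil ->.
apply: (@triangular_perm_eq (enriched_count (size p + size s))) => [k|m].
  exact/first_nonzero_dsum/first_nonzero_profile.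
by rewrite shE // szp szs shE -?szp -?szs // (E p p') // (E s s').
Qed.
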